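(* Let $S$ be a Clifford topological semigroup whose set of idempotents $E(S)$ is a $U_2$-semilattice. Then $S$ embeds topologically into $\mathbb{N}^{\mathbb{N}}$ if and only if $S$ is Hausdorff, ditopological and every maximal subgroup of $S$, as well as the semilattice $E(S)$, embed topologically into $\mathbb{N}^{\mathbb{N}}$.
   Context: An inverse semigroup is a semigroup $S$ such that for each $x\in S$ there is a unique $x^{-1}\in S$ with $xx^{-1}x=x$ and $x^{-1}xx^{-1}=x^{-1}$. It is Clifford if $xx^{-1}=x^{-1}x$ for all $x\in S$. A topological semigroup is a semigroup with a topology for which multiplication is continuous (such a topology is called a semigroup topology). A Clifford topological semigroup is a topological semigroup that is algebraically a Clifford semigroup. $E(S)=\{e\in S: e^2=e\}$ is a semilattice (commutative semigroup of idempotents). The maximal subgroups of $S$ are $H_e=\{x\in S: xx^{-1}=e=x^{-1}x\}$, $e\in E(S)$. $E(S)$ and the $H_e$ carry the subspace topology. For a semilattice $X$, write $x\le y$ if $xy=x$, and ${\uparrow}x=\{y\in X: x\le y\}$. An ideal of $X$ is a subset $I$ with $ab\in I$ for all $a\in I$, $b\in X$. A semilattice $X$ with a topology is a $U_2$-semilattice if for every open set $U$ and every $x\in U$ there exist $y\in U$ and a clopen ideal $I\subseteq X$ such that $x\in X\setminus I\subseteq{\uparrow}y$. An inverse semigroup $S$ with a semigroup topology is called ditopological if inversion is continuous and for any point $x\in S$ and any neighbourhood $O$ of $x$ there are neighbourhoods $U$ and $W$ of $x$ and $xx^{-1}$, respectively, such that $$\{s\in S : \exists b\in U,\ \exists e\in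 W\cap E(S)\text{ such that } b=es\}\cap\{s\in S : ss^{-1}\in W\}\subseteq O.$$ $\mathbb{N}^{\mathbb{N}}$ is the monoid of all functions $\mathbb{N}\to\mathbb{N}$ under composition (functions act on the right and compose from left to right), with the product topology arising from the discrete topology on $\mathbb{N}$. An embedding of semigroups is an injective homomorphism; an embedding $\phi:S\to T$ of topological semigroups is topological if both $\phi$ and $\phi^{-1}:(S)\phi\to S$ are continuous, where $(S)\phi$ has the subspace topology. ''$S$ embeds topologically into $T$'' means such a topological embedding exists. *)

(* Defs.v *)
From HB Require Import structures.
From mathcomp Require Import all_boot monoid all_algebra.
From mathcomp Require Import all_classical topology.

Set Implicit Arguments.
Unset Strict Implicit.
Unset Printing Implicit Defensive.

Local Open Scope classical_set_scope.
Local Open Scope group_scope.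

HB.mixin Record isTopSemigroup S of Semigroup S & Topological S := {
  mulg_continuous : continuous (fun p : S * S => p.1 * p.2)
}.

#[short(type="topSemigroupType")]
HB.structure Definition TopSemigroup :=
  {S of Semigroup S & Topological S & isTopSemigroup S}.

(* The inverse [sinv x] is distinct from the [x^-1] of MathComp groups, which
   presupposes a unit element. *)
HB.mixin Record isInverseSemigroup S of Semigroup S := {
  sinv : S -> S;
  mulgsVg : forall x : S, x * sinv x * x = x;
  mulsVgV : forall x : S, sinv x * x * sinv x = sinv x;
  sinv_unique : forall x y : S, x * y * x = x -> y * x * y = y -> y = sinv x
}.

#[short(type="inverseSemigroupType")]
HB.structure Definition InverseSemigroup :=
  {S of Semigroup S & isInverseSemigroup S}.

(* Only multiplication is assumed to be continuous, not inversion. *)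
#[short(type="inverseTopSemigroupType")]
HB.structure Definition InverseTopSemigroup :=
  {S of InverseSemigroup S & TopSemigroup S}.

Definition clifford (S : inverseSemigroupType) : Prop :=
  forall x : S, x * sinv x = sinv x * x.

Definition idempotents (S : semigroupType) : set S := [set e | e * e = e].

Definition maximal_subgroup_set (S : inverseSemigroupType) (e : S) : set S :=
  [set x | x * sinv x = e /\ e = sinv x * x].

Section InverseSemigroupTheory.
Variable S : inverseSemigroupType.
Implicit Types x y z e f : S.

Lemma sinv_idem e : e * e = e -> sinv e = e.
Proof. by move=> ee; apply/esym/sinv_unique; rewrite !ee. Qed.

Lemma sinvK x : sinv (sinv x) = x.
Proof. by apply/esym/sinv_unique; rewrite ?mulgsVg ?mulsVgV. Qed.

Lemma idempotentsM e f :
  idempotents e -> idempotents f -> idempotents (e * f).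
Proof.
rewrite /idempotents /= => ee ff; set z := sinv (e * f).
have zE : z = f * z * e.
  apply/esym/sinv_unique.
    have -> : e * f * (f * z * e) * (e * f) = e * (f * f) * z * ((e * e) * f).
      by rewrite !mulgA.
    by rewrite ee ff mulgsVg.
  have -> : f * z * e * (e * f) * (f * z * e)
            = f * (z * ((e * e) * (f * f)) * z) * e by rewrite !mulgA.
  by rewrite ee ff mulsVgV.
have zz : z * z = z.
  have {1}-> : z * z = f * z * e * (f * z * e) by rewrite -zE.
  have -> : f * z * e * (f * z * e) = f * (z * (e * f) * z) * e.
    by rewrite !mulgA.
  by rewrite mulsVgV -zE.
by rewrite -(sinvK (e * f)) -/z (sinv_idem zz).
Qed.

Lemma idempotentsC e f : idempotents e -> idempotents f -> e * f = f * e.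
Proof.
move=> ee ff; have efef := idempotentsM ee ff.
have fefe := idempotentsM ff ee.
rewrite -[LHS](sinv_idem efef); apply/esym/sinv_unique.
  have -> : e * f * (f * e) * (e * f) = e * (f * f) * (e * e) * f.
    by rewrite !mulgA.
  by rewrite ee ff -[RHS]efef !mulgA.
have -> : f * e * (e * f) * (f * e) = f * (e * e) * (f * f) * e.
  by rewrite !mulgA.
by rewrite ee ff -[RHS]fefe !mulgA.
Qed.

Lemma idem_sVx x : idempotents (sinv x * x).
Proof. by rewrite /idempotents /= mulgA mulsVgV. Qed.

Lemma idem_xsV x : idempotents (x * sinv x).
Proof. by rewrite /idempotents /= mulgA mulgsVg. Qed.

Lemma sinvM x y : sinv (x * y) = sinv y * sinv x.
Proof.
have C : y * sinv y * (sinv x * x) = sinv x * x * (y * sinv y).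
  by apply: idempotentsC; [exact: idem_xsV|exact: idem_sVx].
apply/esym/sinv_unique.
  have -> : x * y * (sinv y * sinv x) * (x * y)
            = x * (y * sinv y * (sinv x * x)) * y by rewrite !mulgA.
  by rewrite C !mulgA mulgsVg -!mulgA (mulgA y) mulgsVg.
have -> : sinv y * sinv x * (x * y) * (sinv y * sinv x)
          = sinv y * (sinv x * x * (y * sinv y)) * sinv x by rewrite !mulgA.
by rewrite -C !mulgA mulsVgV -!mulgA (mulgA (sinv x)) mulsVgV.
Qed.

Lemma maximal_subgroup_setM e x y :
  maximal_subgroup_set e x -> maximal_subgroup_set e y ->
  maximal_subgroup_set e (x * y).
Proof.
move=> [xe ex] [ye ey]; rewrite /maximal_subgroup_set /= sinvM; split.
  have -> : x * y * (sinv y * sinv x) = x * (y * sinv y) * sinv x.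
    by rewrite !mulgA.
  by rewrite ye {1}ex mulgA mulgsVg.
have -> : sinv y * sinv x * (x * y) = sinv y * (sinv x * x) * y.
  by rewrite !mulgA.
by rewrite -ex -{2}ye mulgA mulsVgV.
Qed.

End InverseSemigroupTheory.

Definition subsemigroup_set (S : semigroupType) (A : set S) : Prop :=
  forall x y, A x -> A y -> A (x * y).

(* The alias carries the closure proof so that the induced multiplication can
   be attached canonically; the topology is the subspace topology that
   MathComp-Analysis puts on [set_type A]. *)
Definition subsemigroup (S : topSemigroupType) (A : set S)
  (clA : subsemigroup_set A) : Type := set_type A.

Section Subsemigroup.
Variables (S : topSemigroupType) (A : set S) (clA : subsemigroup_set A).

HB.instance Definition _ := Topological.copy (subsemigroup clA) (set_type A).

Definition subsemigroup_mul (x y : subsemigroup clA) : subsemigroup clA :=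
  SigSub (mem_set (clA (set_valP x) (set_valP y))).

Lemma subsemigroup_mulA : associative subsemigroup_mul.
Proof. by move=> x y z; apply/val_inj; exact: mulgA. Qed.

HB.instance Definition _ :=
  isSemigroup.Build (subsemigroup clA) subsemigroup_mulA.

Lemma subsemigroup_mul_continuous :
  continuous (fun p : subsemigroup clA * subsemigroup clA => p.1 * p.2).
Proof.
apply: continuous_comp_initial => -[x y].
have vc : continuous (set_val : subsemigroup clA -> S).
  exact: initial_continuous.
apply: (@continuous2_cvg _ _ _ _ _ _ (fun p => set_val p.1)
  (fun p => set_val p.2) (fun a b : S => a * b)).
- exact: (@mulg_continuous S (set_val x, set_val y)).
- by apply: (cvg_comp _ set_val _ (vc x)); exact: cvg_fst.
- by apply: (cvg_comp _ set_val _ (vc y)); exact: cvg_snd.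
Qed.

HB.instance Definition _ :=
  isTopSemigroup.Build (subsemigroup clA) subsemigroup_mul_continuous.

End Subsemigroup.

Definition idempotent_semilattice (S : inverseTopSemigroupType) :
    topSemigroupType :=
  subsemigroup (@idempotentsM S : subsemigroup_set (@idempotents S)).

Definition maximal_subgroup (S : inverseTopSemigroupType) (e : S) :
    topSemigroupType :=
  subsemigroup (@maximal_subgroup_setM S e
                : subsemigroup_set (maximal_subgroup_set e)).

Definition semilattice (X : semigroupType) : Prop :=
  (forall x y : X, x * y = y * x) /\ (forall x : X, x * x = x).

Definition upset (X : semigroupType) (x : X) : set X := [set y | x * y = x].

Definition ideal (X : semigroupType) (I : set X) : Prop :=
  forall a b : X, I a -> I (a * b).

Definition U2_semilattice (X : topSemigroupType) : Prop :=
  semilattice X /\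
  forall (U : set X) (x : X), open U -> U x ->
    exists y : X, U y /\
      exists I : set X,
        [/\ clopen I, ideal I, (~` I) x & ~` I `<=` upset y].

Definition ditopological (S : inverseTopSemigroupType) : Prop :=
  continuous (@sinv S) /\
  forall (x : S) (O : set S), nbhs x O ->
    exists U W : set S, [/\ nbhs x U, nbhs (x * sinv x) W &
      [set s | exists b e, [/\ U b, (W `&` @idempotents S) e & b = e * s]]
      `&` [set s | W (s * sinv s)] `<=` O].

(* Functions act on the right: the product [f * g] is "first f, then g". *)
Definition natfun : Type := {ptws nat -> nat}.

HB.instance Definition _ := Topological.copy natfun {ptws nat -> nat}.

Definition natfun_mul (f g : natfun) : natfun := g \o f.

Lemma natfun_mulA : associative natfun_mul.
Proof. by []. Qed.

Lemma natfun_mul1f : left_id (idfun : natfun) natfun_mul.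
Proof. by []. Qed.

Lemma natfun_mulf1 : right_id (idfun : natfun) natfun_mul.
Proof. by []. Qed.

HB.instance Definition _ :=
  isMonoid.Build natfun natfun_mulA natfun_mul1f natfun_mulf1.

Lemma natfun_mul_continuous : continuous (fun p : natfun * natfun => p.1 * p.2).
Proof.
move=> -[f g]; apply/pointwise_cvgP => t.
have ev (h : natfun) (n : nat) : \forall k \near h, k n = h n.
  apply: (@proj_continuous nat (fun=> nat) n h [set h n]).
  by rewrite nbhs_principalE; exact/principal_filterP.
suff : \forall p \near (f, g), p.2 (p.1 t) = g (f t).
  move=> + U /nbhs_singleton Uf; apply: filterS => p pt.
  by have := Uf; rewrite -[X in U X -> _]pt.
exists ([set k | k t = f t], [set k | k (f t) = g (f t)]) => /=.
  by split; exact: ev.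
by move=> [k l] /= [kt lt]; rewrite kt lt.
Qed.

HB.instance Definition _ := isTopSemigroup.Build natfun natfun_mul_continuous.

(* [psi] is the inverse of [phi] on its image, which has the subspace
   topology. *)
Definition topological_embedding (S T : topSemigroupType) (phi : S -> T) :
    Prop :=
  [/\ injective phi, {morph phi : x y / x * y}, continuous phi &
      exists psi : set_type (range phi) -> S,
        (forall u, phi (psi u) = set_val u) /\ continuous psi].

Definition embeds_topologically (S T : topSemigroupType) : Prop :=
  exists phi : S -> T, topological_embedding phi.

(* Main.v *)
Require Import Defs.
From mathcomp Require Import all_boot all_classical topology.
From mathcomp Require Import monoid.

(** For a Hausdorff topological semigroup [T], an embedding of [T] into the
monoid of transformations of [nat] amounts to countably many maps
[c i : T -> nat] such that [c i] is locally constant, its kernel is a right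
congruence, and finitely many of the values [c i x] confine
[x] to any prescribed neighbourhood.  Given an embedding, [c n x] is the image
of the point [n] under [x] ([embeds_natfun_coordinates]).  Conversely [T] acts
on the right on the countable set of classes of all these congruences, with a
base point added for each of them ([embeds_topologically_natfun]).  Both
implications are proved through such coordinates.

If [S] embeds and is Clifford, then the maps sending [x] to the images of a
point [n] under [x * sinv x] and [sinv x] are locally constant, by computations
with the action of [S] on [nat].  Thus inversion is continuous.  As small
neighbourhoods in [S] prescribe the action on finitely many points, the
ditopological property reduces to identities between images of these points
([embedded_ditopological]).

Conversely, write [e_x = x * sinv x].  Idempotents of a Clifford semigroup are
central, so [x |-> e_x] is a homomorphism onto the semilattice [E] of
idempotents and the coordinates of [E] pull back to [S].  They control [e_x]
only.  The rest of [x] is seen through pairs [(y, F)], where [F] is a clopen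
subset of [E] all of whose elements lie above [y], and [a * b] is in [F] exactly
when [a] and [b] are.  Then [x |-> x * y] is a homomorphism from the [x] with
[e_x] in [F] to the maximal subgroup at [y].  Applying a coordinate of that
group, and giving all other [x] one extra value, has a right congruence as its
kernel because the complement of [F] is an ideal and [F] is multiplicatively
closed ([translate_coordinates]).

The U2 property yields clopen ideals whose complement need not be closed under
products.  The countably many congruences on [E] repair this: inside such a
complement, around each of its points, there is a set [F] as above
([U2_filter]).  Since [E] has a countable base, countably many pairs suffice:
one is selected for each pair of basic sets.  Finally, given a neighbourhood of
[x], the ditopological property says that [z] belongs to it as soon as [z * y]
is close to [x] for some idempotent [y] close to [e_x], and [e_z] is close to
[e_x].  The coordinates of [E] give the latter, and those attached to a pair
[(y, F)] with [e_x] in [F] and [y] close to [e_x] give the former, since then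
[x * y] is close to [x]. *)

Set Implicit Arguments.
Unset Strict Implicit.
Unset Printing Implicit Defensive.

Local Open Scope classical_set_scope.
Local Open Scope group_scope.

(** * Right congruence coordinates *)

(** For a [Prop]-valued map, that is a set, this means being clopen. *)
Definition locally_constant (T : topologicalType) (V : Type) (c : T -> V) :=
  forall x, \forall y \near x, c y = c x.

(** The kernel of [c] is a right congruence. *)
Definition right_compatible (T : semigroupType) (c : T -> nat) :=
  forall x y z, c x = c y -> c (x * z) = c (y * z).

Definition agree_on (I : eqType) (T V : Type) (c : I -> T -> V) (s : seq I)
    (x : T) : set T :=
  [set y | forall i, i \in s -> c i y = c i x].

Definition generates_nbhs (I : eqType) (T : topologicalType) (V : Type)
    (c : I -> T -> V) :=
  forall x O, nbhs x O -> exists s, agree_on c s x `<=` O.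

Definition right_coordinates (I : eqType) (T : topSemigroupType)
    (c : I -> T -> nat) :=
  [/\ forall i, right_compatible (c i), forall i, locally_constant (c i) &
      generates_nbhs c].

Lemma filter_seq (I : eqType) (T : Type) (F : set_system T) (s : seq I)
    (P : I -> T -> Prop) :
  Filter F -> (forall i, i \in s -> \forall y \near F, P i y) ->
  \forall y \near F, forall i, i \in s -> P i y.
Proof.
move=> FF; elim: s => [|i s IH] Ps; first exact: nearW.
have /IH Hs j : j \in s -> \forall y \near F, P j y.
  by move=> js; apply: Ps; rewrite inE js orbT.
have Hi : \forall y \near F, P i y by apply: Ps; rewrite inE eqxx.
by apply: filterS2 Hi Hs => y Piy Psy j; rewrite inE => /predU1P[->|/Psy].
Qed.

Lemma nbhs_agree_on (I : eqType) (T : topologicalType) (V : Type)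
    (c : I -> T -> V) (s : seq I) (x : T) :
  (forall i, locally_constant (c i)) -> nbhs x (agree_on c s x).
Proof. by move=> lc; apply: filter_seq => i _; exact: lc. Qed.

Lemma locally_constant_comp (T U : topologicalType) (V : Type) (c : U -> V)
    (f : T -> U) :
  locally_constant c -> continuous f -> locally_constant (c \o f).
Proof. by move=> lc cf x; exact: (cf x _ (lc (f x))). Qed.

Lemma natfun_eval_locally_constant n :
  locally_constant (fun f : natfun => f n).
Proof.
move=> f; apply: (@proj_continuous nat (fun=> nat) n f [set f n]).
by rewrite nbhs_principalE; exact/principal_filterP.
Qed.

(** The sets containing some [agree_on] class of [f] form a filter, which
converges to [f] pointwise; so it contains all neighbourhoods of [f]. *)
Lemma natfun_eval_generates :
  generates_nbhs (fun n (f : natfun) => f n).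
Proof.
move=> f.
pose F : set_system natfun :=
  [set A | exists s, agree_on (fun n (g : natfun) => g n) s f `<=` A].
have FF : Filter F.
  split=> [|A B [s sA] [t tB]|A B AB [s sA]].
  - by exists [::].
  - exists (s ++ t) => g gst; split.
      by apply: sA => n ns; apply: gst; rewrite mem_cat ns.
    by apply: tB => n nt; apply: gst; rewrite mem_cat nt orbT.
  - by exists s; exact: subset_trans AB.
suff : F --> f by [].
apply/pointwise_cvgP => n A /nbhs_singleton Af.
exists [:: n] => g /(_ n); rewrite inE eqxx => /(_ isT) gf.
by rewrite /= gf.
Qed.

(** The topology of [natfun] is generated by the evaluations, so continuity of
[phi] and of its inverse can be tested on the coordinates [phi ^~ n]. *)
Lemma topological_embedding_natfunP (T : topSemigroupType) (phi : T -> natfun) :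
  topological_embedding phi <->
  [/\ injective phi, {morph phi : x y / x * y},
      forall n, locally_constant (phi ^~ n) &
      generates_nbhs (fun n x => phi x n)].
Proof.
split=> [[inj mor cont [psi [psiK psi_cont]]]|[inj mor lc gen]].
  split=> // [n|x O xO].
    exact: (@locally_constant_comp T natfun nat (fun f => f n) phi
      (@natfun_eval_locally_constant n) cont).
  pose u : set_type (range phi) := SigSub (mem_set (imageT phi x)).
  have psiu : psi u = x by apply: inj; rewrite psiK.
  have : nbhs (psi u) O by rewrite psiu.
  move=> /psi_cont [_ [[B Bo <-] Bu BO]].
  have [s sB] : exists s, agree_on (fun n (g : natfun) => g n) s (phi x)
      `<=` B.
    by apply: natfun_eval_generates; apply: open_nbhs_nbhs; split.
  exists s => y yx.
  pose v : set_type (range phi) := SigSub (mem_set (imageT phi y)).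
  have <- : psi v = y by apply: inj; rewrite psiK.
  by apply: (BO v); exact: sB.
split=> //.
  move=> x; apply/(@pointwise_cvgP _ _ (phi @ x)) => n A /nbhs_singleton Ax.
  by apply: filterS (lc n x) => y /= yx; rewrite /= yx.
have /choice[psi psiK] (u : set_type (range phi)) :
    exists x, phi x = set_val u.
  by have [x _ xu] := set_valP u; exists x.
exists psi; split=> // u O /gen[s sO].
have near_u : \forall v \near u, agree_on (fun n (g : natfun) => g n) s
    (set_val u) (set_val v).
  exact: (@initial_continuous _ _ (set_val : set_type (range phi) -> natfun) u
  _ (@nbhs_agree_on _ _ _ (fun n (g : natfun) => g n) s (set_val u)
       natfun_eval_locally_constant)).
apply: (@filterS _ (nbhs u) _ _ _ _ near_u) => v vu.
by apply: sO => n ns; rewrite !psiK; exact: vu.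
Qed.

(** * Embeddings from coordinates, and conversely *)

Lemma mulgl_continuous (T : topSemigroupType) (a : T) :
  continuous (fun x => a * x).
Proof.
move=> x; apply: (@continuous2_cvg _ _ _ _ _ _ (fun=> a) id
  (fun a b : T => a * b)).
- exact: (@mulg_continuous T (a, x)).
- exact: cvg_cst.
- exact: cvg_id.
Qed.

Lemma mulgr_continuous (T : topSemigroupType) (a : T) :
  continuous (fun x => x * a).
Proof.
move=> x; apply: (@continuous2_cvg _ _ _ _ _ _ id (fun=> a)
  (fun a b : T => a * b)).
- exact: (@mulg_continuous T (x, a)).
- exact: cvg_id.
- exact: cvg_cst.
Qed.

Lemma natfun_mulE (f g : natfun) n : (f * g) n = g (f n).
Proof. by []. Qed.

Section ActionOnClasses.
Variables (I : countType) (T : topSemigroupType) (c : I -> T -> nat).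

(** Right multiplication by [x] on the classes of the kernels of the [c i]: the
class of value [v] for [c i] is encoded as [(i, Some v)], and a base point
[(i, None)], playing the part of the class of an adjoined unit, records the
value of [c i] at [x].  Codes of values that [c i] does not take are fixed. *)
Definition class_act (x : T) (p : I * option nat) : I * option nat :=
  (p.1, Some (if p.2 is Some v then
                if pselect (exists s, c p.1 s = v) is left vP
                then c p.1 (projT1 (cid vP) * x) else v
              else c p.1 x)).

Definition class_action (x : T) : natfun := fun n =>
  if unpickle n is Some p then pickle (class_act x p) else n.

Hypothesis c_right : forall i, right_compatible (c i).

Lemma class_actM x y p : class_act (x * y) p = class_act y (class_act x p).
Proof.
case: p => i [v|]; rewrite /class_act /=; last first.
  case: pselect => [vP|]; last by case; exists x.
  by case: (cid vP) => s /= /c_right ->.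
case: (pselect (exists s, c i s = v)) => [vP|nP]; last by case: pselect.
case: pselect => [wP|]; last by case; exists (projT1 (cid vP) * x).
by case: (cid wP) => s /= /(@c_right i _ _ y) ->; rewrite mulgA.
Qed.

(** The base points make every [c i] visible in the action, hence the action
separates points and generates the topology. *)
Lemma embeds_topologically_natfun :
  hausdorff_space T -> (forall i, locally_constant (c i)) ->
  generates_nbhs c -> embeds_topologically T natfun.
Proof.
move=> T2 lc gen; exists class_action.
apply/topological_embedding_natfunP.
have c_action i x y : class_action x (pickle (i, @None nat)) =
    class_action y (pickle (i, @None nat)) -> c i x = c i y.
  by rewrite /class_action !pickleK => /(pcan_inj pickleK) [].
have agree_action s x : agree_on (fun n x => class_action x n)
    [seq pickle (i, @None nat) | i <- s] x `<=` agree_on c s x.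
  by move=> y yx i si; apply: c_action; apply: yx; exact: map_f.
split.
- move=> x y xy; apply: T2 => A B Ax By.
  have [s sA] := gen _ _ Ax.
  exists y; split; last exact: nbhs_singleton.
  by apply/sA/agree_action => n _; rewrite xy.
- move=> x y; apply: funext => n; rewrite /class_action.
  rewrite natfun_mulE.
  case nE: (unpickle n) => [p|]; last by rewrite nE.
  by rewrite pickleK class_actM.
- move=> n x; rewrite /class_action.
  case: (unpickle n) => [[i [v|]]|]; last exact: nearW; last first.
    by apply: filterS (lc i x) => y yx; rewrite /class_act /= yx.
  rewrite /class_act /=; case: pselect => [vP|_]; last exact: nearW.
  have := @locally_constant_comp _ _ _ _ _ (lc i)
    (@mulgl_continuous T (projT1 (cid vP))) x.
  by apply: filterS => y /= ->.
- move=> x O /gen[s sO].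
  by exists [seq pickle (i, @None nat) | i <- s]; exact: subset_trans sO.
Qed.

End ActionOnClasses.

Lemma embeds_natfun_coordinates (T : topSemigroupType) :
  embeds_topologically T natfun -> exists c : nat -> T -> nat,
  right_coordinates c.
Proof.
move=> [phi /topological_embedding_natfunP[_ mor lc gen]].
exists (fun n x => phi x n); split=> // n x y z xy.
by rewrite !mor !natfun_mulE xy.
Qed.

Lemma embeds_hausdorff (T : topSemigroupType) :
  embeds_topologically T natfun -> hausdorff_space T.
Proof.
move=> [phi /topological_embedding_natfunP[inj _ lc _]] x y xy.
apply: inj; apply: funext => n.
by have [z [/= <- <-]] := xy _ _ (lc n x) (lc n y).
Qed.

Lemma subsemigroup_embeds (T : topSemigroupType) (A : set T)
    (clA : subsemigroup_set A) :
  embeds_topologically T natfun ->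
  embeds_topologically (subsemigroup clA) natfun.
Proof.
move=> [phi /topological_embedding_natfunP[inj mor lc gen]].
have val_cont : continuous (set_val : subsemigroup clA -> T).
  exact: initial_continuous.
exists (phi \o set_val); apply/topological_embedding_natfunP; split.
- by move=> x y /= /inj /val_inj.
- by move=> x y; exact: mor.
- by move=> n; apply: (@locally_constant_comp _ _ _ (phi ^~ n) set_val).
- move=> x O [_ [[B Bo <-] Bx BO]].
  have [s sB] := gen _ _ (open_nbhs_nbhs (conj Bo Bx)).
  by exists s => y yx; apply/BO/sB.
Qed.

(** * Algebra of Clifford semigroups *)

Section CliffordAlgebra.
Variables (S : inverseSemigroupType) (cliffordS : clifford S).
Implicit Types x y e f : S.

(** Both [e * x] and [x * e] equal [x * (e * (x * sinv x))]: for the former, the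
two idempotents attached to [e * x] coincide. *)
Lemma idempotent_central e x : e * e = e -> e * x = x * e.
Proof.
move=> ee.
have sxex : sinv x * e * x = e * (x * sinv x).
  have := cliffordS (e * x); rewrite sinvM (sinv_idem ee) => H.
  have -> : sinv x * e * x = sinv x * e * (e * x).
    by rewrite !mulgA -(mulgA (sinv x) e e) ee.
  rewrite -H.
  have -> : e * x * (sinv x * e) = e * (x * sinv x * e) by rewrite !mulgA.
  by rewrite (idempotentsC (idem_xsV x) ee) mulgA ee.
have xsxex : x * (sinv x * e * x) = e * x.
  have -> : x * (sinv x * e * x) = x * sinv x * e * x by rewrite !mulgA.
  by rewrite (idempotentsC (idem_xsV x) ee) -mulgA mulgsVg.
rewrite -xsxex sxex (idempotentsC ee (idem_xsV x)) !mulgA.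
by rewrite -(mulgA x x) cliffordS mulgA mulgsVg.
Qed.

Lemma unit_partM x y : x * y * sinv (x * y) = x * sinv x * (y * sinv y).
Proof.
rewrite sinvM.
have -> : x * y * (sinv y * sinv x) = x * (y * sinv y * sinv x).
  by rewrite !mulgA.
by rewrite (idempotent_central _ (idem_xsV y)) mulgA.
Qed.

End CliffordAlgebra.

(** * Clifford subsemigroups of the transformation monoid are ditopological *)

Section EmbeddedDitopological.
Variables (S : inverseTopSemigroupType) (cliffordS : clifford S).
Variable phi : S -> natfun.
Hypothesis phiM : {morph phi : x y / x * y}.
Hypothesis phi_lc : forall n, locally_constant (phi ^~ n).

Let actM x y n : phi (x * y) n = phi y (phi x n).
Proof. by rewrite phiM. Qed.

Let unit_part_fix x n : phi (x * sinv x) (phi x n) = phi x n.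
Proof. by rewrite -actM cliffordS mulgA mulgsVg. Qed.

(** Let [p] be the image of [n] under [x * sinv x].  If [y] acts as [x] on [n]
and on [p], then [n] and [p] have the same image under [y], hence under
[y * sinv y].  Moreover [p] is in the image of [x]; if [y] also acts as [x] on a
preimage, then [p] is in the image of [y] and is fixed by [y * sinv y]. *)
Lemma unit_part_locally_constant n :
  locally_constant (fun x => phi (x * sinv x) n).
Proof.
move=> x /=; set p := phi (x * sinv x) n.
have pE : p = phi x (phi (sinv x) n) by rewrite -actM -cliffordS.
apply: filterS3 (phi_lc n x) (phi_lc p x) (phi_lc (phi (sinv x) n) x).
move=> y yn yp ym.
have fix_p : phi (y * sinv y) p = p by rewrite pE -ym unit_part_fix.
have xp : phi x p = phi x n by rewrite -actM mulgsVg.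
by rewrite -[RHS]fix_p !actM yn yp xp.
Qed.

(** Let [p] be the image of [n] under [sinv x].  If [y] acts as [x] on [p] and
[y * sinv y] acts as [x * sinv x] on [n] and [p], then [y] sends [p] to the
image of [n] under [y * sinv y], so that [sinv y] sends [n] to the image of [p]
under [y * sinv y], which is [p]. *)
Lemma sinv_locally_constant n : locally_constant (fun x => phi (sinv x) n).
Proof.
move=> x /=; set p := phi (sinv x) n.
apply: filterS3 (phi_lc p x) (unit_part_locally_constant n x)
  (unit_part_locally_constant p x) => y yp en ep.
have -> : sinv y = y * sinv y * sinv y by rewrite cliffordS mulsVgV.
rewrite actM en cliffordS actM -/p -yp -actM ep.
by rewrite -actM mulgA mulsVgV.
Qed.

Lemma embedded_ditopological :
  generates_nbhs (fun n x => phi x n) -> ditopological S.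
Proof.
move=> gen; split=> [x O /gen[s sO]|x O /gen[s sO]].
  suff : \forall y \near x, agree_on (fun n x => phi x n) s (sinv x) (sinv y).
    by apply: filterS => y /sO.
  by apply: filter_seq => n _; exact: sinv_locally_constant.
set e := x * sinv x.
(* On [s], [t] acts as [t * sinv t] followed by [t], hence as [e] followed by
   [t], as [f] followed by [t], as [b], and as [x]. *)
exists (agree_on (fun n y => phi y n) s x), (agree_on (fun n y => phi y n) s e).
split; [exact: nbhs_agree_on | exact: nbhs_agree_on |].
move=> t [[b [f [bx [fe _] bE]]] te]; apply: sO => n ns.
rewrite -(bx n ns) bE actM (fe n ns) -(te n ns) -(actM (t * sinv t)).
by rewrite mulgsVg.
Qed.

End EmbeddedDitopological.

(** * Coordinates from a maximal subgroup *)

Section TranslateCoordinates.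
Variables (S : inverseTopSemigroupType) (cliffordS : clifford S).
Hypothesis sinv_continuous : continuous (@sinv S).

Definition unit_part (x : S) : idempotent_semilattice S :=
  SigSub (mem_set (idem_xsV x)).

Lemma unit_part_morph : {morph unit_part : x y / x * y}.
Proof. by move=> x y; apply: val_inj; exact: unit_partM. Qed.

Lemma unit_part_continuous : continuous unit_part.
Proof.
apply: continuous_comp_initial => x.
apply: (@continuous2_cvg _ _ _ _ _ _ id (@sinv S) (fun a b : S => a * b)).
- exact: (@mulg_continuous S (x, sinv x)).
- exact: cvg_id.
- exact: sinv_continuous.
Qed.

(** The filters of a semilattice, with the empty set allowed. *)
Definition filter_set (X : semigroupType) (F : set X) :=
  forall a b, F (a * b) <-> F a /\ F b.

Lemma upset_maximal_subgroup (y : idempotent_semilattice S) (x : S) :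
  upset y (unit_part x) -> maximal_subgroup_set (set_val y) (x * set_val y).
Proof.
move=> /(congr1 set_val) /= yx; have yy : idempotents (set_val y).
  exact: set_valP.
have E : x * set_val y * sinv (x * set_val y) = set_val y.
  rewrite unit_partM // (sinv_idem yy) yy.
  by rewrite (idempotentsC (idem_xsV x) yy).
by split=> //; rewrite -cliffordS.
Qed.

(** The map [x |-> x * y] is multiplicative where the unit part of [x] is in
[F]; [d i] is the [i]-th coordinate of [x * y] there, shifted by one, and zero
elsewhere.  As [F] is a filter, whether [x * w] falls in the zero class depends
only on whether [x] and [w] do. *)
Lemma translate_coordinates (y : idempotent_semilattice S)
    (F : set (idempotent_semilattice S)) :
  embeds_topologically (maximal_subgroup (set_val y)) natfun ->
  locally_constant F -> filter_set F -> F `<=` upset y ->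
  exists d : nat -> S -> nat,
    [/\ forall i, right_compatible (d i), forall i, locally_constant (d i) &
     forall x U, F (unit_part x) -> nbhs (x * set_val y) U ->
       exists s, forall z, agree_on d s x z -> U (z * set_val y)].
Proof.
move=> /embeds_natfun_coordinates[c [c_right c_lc c_gen]] F_lc Ffil Fy.
pose proj x (Fx : F (unit_part x)) : maximal_subgroup (set_val y) :=
  SigSub (mem_set (upset_maximal_subgroup (Fy _ Fx))).
have projP x (Fx Fx' : F (unit_part x)) : proj x Fx = proj x Fx'.
  exact: val_inj.
pose d i x := if pselect (F (unit_part x)) is left Fx then (c i (proj x Fx)).+1
              else 0.
have dT i x (Fx : F (unit_part x)) : d i x = (c i (proj x Fx)).+1.
  by rewrite /d; case: pselect => // Fx'; rewrite (projP _ Fx' Fx).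
have dF i x : ~ F (unit_part x) -> d i x = 0.
  by rewrite /d; case: pselect.
have F_near x : \forall z \near x, F (unit_part z) = F (unit_part x).
  exact: (@locally_constant_comp _ _ _ F unit_part F_lc unit_part_continuous).
have near_proj x (Fx : F (unit_part x))
    (A : set (maximal_subgroup (set_val y))) :
    nbhs (proj x Fx) A ->
    \forall z \near x, forall Fz : F (unit_part z), A (proj z Fz).
  move=> [_ [[B Bo <-] Bx BA]].
  have Bn : \forall z \near x, B (z * set_val y).
    exact: mulgr_continuous (open_nbhs_nbhs (conj Bo Bx)).
  by apply: filterS Bn => z Bz Fz; exact: BA.
exists d; split.
- move=> i x z w.
  have FM u : F (unit_part (u * w)) <-> F (unit_part u) /\ F (unit_part w).
    by rewrite unit_part_morph; exact: Ffil.
  have [Fx|nFx] := pselect (F (unit_part x)); last first.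
    rewrite (dF _ _ nFx) => zx; rewrite !dF // => /FM[] // Fz _.
    by move: zx; rewrite (dT _ _ Fz).
  have [Fz|nFz] := pselect (F (unit_part z)); last by rewrite (dT _ _ Fx) dF.
  rewrite (dT _ _ Fx) (dT _ _ Fz) => -[xz].
  have [Fw|nFw] := pselect (F (unit_part w)); last by rewrite !dF // => /FM[].
  have projM u (Fu : F (unit_part u)) (Fuw : F (unit_part (u * w))) :
      proj (u * w) Fuw = proj u Fu * proj w Fw.
    apply: val_inj => /=.
    have yy : idempotents (set_val y) by exact: set_valP.
    rewrite [RHS]mulgA -(mulgA u (set_val y) w).
    by rewrite (idempotent_central cliffordS w yy) -!mulgA yy.
  have Fxw : F (unit_part (x * w)) by apply/FM.
  have Fzw : F (unit_part (z * w)) by apply/FM.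
  by rewrite (dT _ _ Fxw) (dT _ _ Fzw) !(projM _ _ _) (c_right _ _ _ _ xz).
- move=> i x; have [Fx|nFx] := pselect (F (unit_part x)).
    apply: filterS2 (F_near x) (near_proj x Fx _ (c_lc i (proj x Fx))) => z.
    by rewrite (dT _ _ Fx) => zx; have Fz : F (unit_part z) by
      [rewrite zx]; move=> /(_ Fz); rewrite (dT _ _ Fz) => ->.
  apply: filterS (F_near x) => z zx.
  by rewrite !dF ?zx.
- move=> x U Fx xU.
  have [s sU] := c_gen (proj x Fx) (set_val @^-1` U)
    (@initial_continuous _ _ (set_val : maximal_subgroup (set_val y) -> S)
      (proj x Fx) U xU).
  (* With no coordinate at all, [unit_part z] could lie outside [F]. *)
  exists (0 :: s) => z zx.
  have [Fz|nFz] := pselect (F (unit_part z)); last first.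
    by have := zx 0; rewrite inE eqxx dF // (dT _ _ Fx) => /(_ isT).
  suff cz : agree_on c s (proj x Fx) (proj z Fz) by exact: (sU _ cz).
  move=> i si.
  have := zx i; rewrite inE si orbT (dT _ _ Fx) (dT _ _ Fz) => /(_ isT).
  by case.
Qed.

End TranslateCoordinates.

(** * Countably many clopen filters *)

(** The U2 property gives a clopen ideal [J] with [x] outside [J] and the
complement of [J] above [y].  The class of [x] for finitely many coordinates
avoids [J], and [F] collects the elements whose class in the quotient
semilattice is above that of [x].  Being the preimage of a principal filter of
a discrete quotient, [F] is a clopen filter; it avoids [J] since [f * x] would
be in the ideal [J] together with [f]. *)
Lemma U2_filter (X : topSemigroupType) (I : eqType) (c : I -> X -> nat) :
  U2_semilattice X -> right_coordinates c ->
  forall (x : X) (U : set X), nbhs x U -> exists (y : X) (F : set X),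
    [/\ U y, locally_constant F, filter_set F, F x & F `<=` upset y].
Proof.
move=> [[XC XX] XU2] [c_right c_lc c_gen] x U.
rewrite nbhsE => -[O [Oo Ox] OU].
have [y [Oy [J [[_ Jc] Jid Jx Jy]]]] := XU2 _ _ Oo Ox.
have [s sJ] := c_gen _ _ (open_nbhs_nbhs (conj (closed_openC Jc) Jx)).
pose F : set X := [set f | agree_on c s x (f * x)].
exists y, F; split; first exact: OU.
- move=> f.
  have near_f : \forall g \near f, agree_on c s (f * x) (g * x).
    exact: (@mulgr_continuous X x f _ (nbhs_agree_on s (f * x) c_lc)).
  apply: filterS near_f => g gf; apply/propext; split=> H i si.
    by rewrite -(gf i si) H.
  by rewrite (gf i si) H.
- have Fl f g : F (f * g) -> F f.
    move=> Ffg i si; have /(c_right _ _ _ f) := Ffg i si.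
    have -> : f * g * x * f = f * g * x.
      by rewrite -!mulgA (XC x) (XC _ (f * x)) -mulgA (XC x) !mulgA XX.
    by rewrite Ffg // (XC x).
  move=> f g; split=> [Ffg|[Ff Fg] i si].
    by split; [exact: Fl Ffg | apply: (Fl _ f); rewrite XC].
  by rewrite -mulgA XC (c_right _ _ _ _ (Fg i si)) XC Ff.
- by move=> i si; rewrite XX.
- move=> f Ff; apply: Jy => Jf; exact: (sJ _ Ff (Jid _ _ Jf)).
Qed.

(** The basic open sets [agree_on c s x], indexed by finite data instead of by
[x]; there are countably many of them. *)
Definition box (I : eqType) (T V : eqType) (c : I -> T -> V) (l : seq (I * V)) :
    set T :=
  [set f | forall p, p \in l -> c p.1 f = p.2].

Lemma box_agree_on (I : eqType) (T V : eqType) (c : I -> T -> V) s x :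
  box c [seq (i, c i x) | i <- s] = agree_on c s x.
Proof.
apply/seteqP; split=> [f fx i si|f fx _ /mapP[i si ->]]; last exact: fx.
by apply: (fx (i, c i x)); exact: map_f.
Qed.

Theorem theorem2p12 (S : inverseTopSemigroupType)
  (cliffordS : clifford S)
  (U2S : U2_semilattice (idempotent_semilattice S)) :
  embeds_topologically S natfun <->
  [/\ hausdorff_space S,
      ditopological S,
      (forall e : S, idempotents e ->
         embeds_topologically (maximal_subgroup e) natfun) &
      embeds_topologically (idempotent_semilattice S) natfun].
Proof.
split=> [emb|[T2 [sinv_cont ditop] embH embE]].
  split; [exact: embeds_hausdorff| |by move=> e _; exact: subsemigroup_embeds|
    exact: subsemigroup_embeds].
  have [phi /topological_embedding_natfunP[_ mor lc gen]] := emb.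
  exact: embedded_ditopological gen.
set E := idempotent_semilattice S.
have [c c_coord] := embeds_natfun_coordinates embE.
have [c_right c_lc c_gen] := c_coord.
pose K : Type := seq (nat * nat) * seq (nat * nat).
pose admissible (k : K) (y : E) (F : set E) :=
  [/\ box c k.1 y, locally_constant F, filter_set F, F `<=` upset y &
      box c k.2 `<=` F].
(* As in the proof that second countable spaces are Lindelof: for each pair [k]
   of boxes, choose a pair [(y, F)] with [y] in the first box and [F] containing
   the second one, whenever there is any. *)
have /choice[d dP] (k : K) : exists d : nat -> S -> nat,
    [/\ forall i, right_compatible (d i), forall i, locally_constant (d i) &
     (exists y F, admissible k y F) -> exists y F, admissible k y F /\
       forall x U, F (unit_part x) -> nbhs (x * set_val y) U ->
       exists s, forall z, agree_on d s x z -> U (z * set_val y)].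
  have [[y [F adm]]|no_adm] := pselect (exists y F, admissible k y F);
    last by exists (fun _ _ => 0); split=> // i x; exact: nearW.
  have [_ F_lc Ffil Fy _] := adm.
  have [d [d_right d_lc d_gen]] := translate_coordinates cliffordS sinv_cont
    (embH _ (set_valP y)) F_lc Ffil Fy.
  by exists d; split=> // _; exists y, F.
pose C (i : nat + K * nat) (x : S) : nat :=
  match i with inl j => c j (unit_part x) | inr kj => d kj.1 kj.2 x end.
apply: (@embeds_topologically_natfun _ S C) => // [[j|[k j]]|[j|[k j]]|].
- by move=> x y z /= xy; rewrite !unit_part_morph //; exact: c_right.
- by have [+ _ _] := dP k; apply.
- exact: (locally_constant_comp (c_lc j)
    (unit_part_continuous sinv_cont)).
- by have [_ + _] := dP k; apply.
move=> x O /ditop[U [W [+ xW UWO]]].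
rewrite nbhsE => -[V [Vo xV] VU].
pose e := unit_part x.
have val_cont : continuous (set_val : E -> S) by exact: initial_continuous.
have eW : \forall f \near e, W (set_val f) by exact: val_cont.
(* Since [x * e = x], idempotents [f] close to [e] keep [x * f] in [V]. *)
have eV : \forall f \near e, V (x * set_val f).
  have xe : x * (x * sinv x) = x by rewrite cliffordS mulgA mulgsVg.
  apply: (val_cont e [set f | V (x * f)]).
  by apply: mulgl_continuous; apply: open_nbhs_nbhs; rewrite /= xe.
have [s sVW] := c_gen _ _ (filterI eW eV).
have [t tW] := c_gen _ _ eW.
have [y [F [ys F_lc Ffil Fe Fy]]] :=
  U2_filter U2S c_coord (nbhs_agree_on s e c_lc).
have [r rF] : exists r, agree_on c r e `<=` F.
  by apply: c_gen; apply: filterS (F_lc e) => f ->.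
pose k : K := ([seq (i, c i e) | i <- s], [seq (i, c i e) | i <- r]).
(* The pair just found shows that [k] admits a pair; the one chosen for [k]
   replaces it from here on. *)
have [_ _ []] := dP k.
  by exists y, F; split; rewrite // box_agree_on.
move=> {y F ys F_lc Ffil Fe Fy rF} y [F [[ys _ _ Fy rF] d_gen]].
move: ys rF; rewrite !box_agree_on => /sVW[/= yW yV] rF.
have [q qV] := d_gen x V (rF e (fun _ _ => erefl))
  (open_nbhs_nbhs (conj Vo yV)).
exists ([seq inl j | j <- t] ++ [seq inr (k, j) | j <- q]) => z zx.
apply: UWO; split; last first.
  apply: (tW (unit_part z)) => j tj.
  by apply: (zx (inl j)); rewrite mem_cat map_f.
have yy : idempotents (set_val y) by exact: set_valP.
exists (z * set_val y), (set_val y); split; last 2 first.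
- by split.
- by rewrite (idempotent_central cliffordS _ yy).
apply/VU/qV => j qj; apply: (zx (inr (k, j))).
by rewrite mem_cat orbC (map_f (fun j => inr (k, j))).
Qed.
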